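(* Let $m \geq 2$ be an integer, let $B = \langle h_0, t \mid t^{-1} h_0 t = h_0^{m+1} \rangle$ and let $H = \langle h_0 \rangle \leq B$. a) Let $K$ be a nonzero commutative ring with $m+1 \in K^*$. Then the ring $\mathrm{End}_{KB}(\mathrm{Ind}_H^B(K))$ is not directly finite. b) Let $X = B/H = \{ bH \mid b \in B\}$, regarded as one $B$-orbit with $B$ acting by left multiplication, and let $G = (\mathbb{Z}/m\mathbb{Z}) \wr_X B$. Then $B$ is Hopfian but $G$ is not Hopfian.
   Context: All modules and actions are left ones, and rings have a unit; $K^*$ denotes the group of invertible elements of $K$. A ring $R$ with unit is directly finite if for all $a,b \in R$, $ab = 1$ implies $ba = 1$. $\mathrm{Ind}_H^B(K) = KB \otimes_{KH} K$, where $K$ is the trivial $KH$-module; equivalently it is the permutation module $K[B/H]$. A group is Hopfian if it has no proper quotient isomorphic to itself (equivalently, every surjective endomorphism is an isomorphism). For an abelian group $A$ and a group $B$ acting on the left on a set $X$ (action written $b*x$), the combinatorial wreath product is $A \wr_X B = M \rtimes B$ with $M = AX = \bigoplus_{x\in X} Ax$, $Ax \simeq A$, and $b\left(\sum_x a_x x\right)b^{-1} = \sum_x a_x (b*x)$ for $b\in B$. *)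

(* Defs.v *)
From HB Require Import structures.
From mathcomp Require Import all_boot all_order all_algebra.
From mathcomp Require Import finmap boolp.
From mathcomp.multinomials Require Import monalg.

Set Implicit Arguments.
Unset Strict Implicit.
Unset Printing Implicit Defensive.

Import GRing.Theory.

Local Open Scope ring_scope.
Local Open Scope quotient_scope.

Definition directly_finite (R : pzRingType) : Prop :=
  forall a b : R, a * b = 1 -> b * a = 1.

(* Between groups, {multiplicative _ -> _} is the type of homomorphisms. *)
Definition hopfian (G : groupType) : Prop :=
  forall f : {multiplicative G -> G},
    (forall y : G, exists x : G, f x = y) -> bijective f.

Section Presentation.
Variable I : choiceType.

(* The letter (i, false) is the generator i, and (i, true) its inverse. *)
Definition word : Type := seq (I * bool).

(* rels lists the defining relations l = r as pairs (l, r). *)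
Variable rels : seq (word * word).

Inductive pres_cong : word -> word -> Prop :=
| pres_cancel i b : pres_cong [:: (i, b); (i, ~~ b)] [::]
| pres_rel r : r \in rels -> pres_cong r.1 r.2
| pres_cat u u' v v' :
    pres_cong u u' -> pres_cong v v' -> pres_cong (u ++ v) (u' ++ v')
| pres_refl u : pres_cong u u
| pres_sym u v : pres_cong u v -> pres_cong v u
| pres_trans u v w : pres_cong u v -> pres_cong v w -> pres_cong u w.

Definition pres_eqv (u v : word) : bool := `[< pres_cong u v >].

Lemma pres_eqv_equiv : equiv_class_of pres_eqv.
Proof.
split=> [u|u v|v u w].
- by apply/asboolP; exact: pres_refl.
- by apply/asboolP/asboolP; exact: pres_sym.
- by move=> /asboolP uv /asboolP vw; apply/asboolP; exact: pres_trans uv vw.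
Qed.

Canonical pres_equiv_rel := EquivRelPack pres_eqv_equiv.
Canonical pres_encModRel := defaultEncModRel pres_eqv.

Definition presented : Type := {eq_quot pres_eqv}.
HB.instance Definition _ : EqQuotient word pres_eqv presented :=
  EqQuotient.on presented.
HB.instance Definition _ := Choice.on presented.

Definition pres_class (u : word) : presented := \pi_presented u.

Definition pres_gen (i : I) : presented := pres_class [:: (i, false)].

Definition winv (u : word) : word := rev [seq (l.1, ~~ l.2) | l <- u].

Definition pres_one : presented := pres_class [::].
Definition pres_inv (x : presented) : presented := pres_class (winv (repr x)).
Definition pres_mul (x y : presented) : presented :=
  pres_class (repr x ++ repr y).

Lemma pres_classP u v : pres_class u = pres_class v <-> pres_cong u v.
Proof.
split=> [/eqP|uv]; first by rewrite eqmodE => /asboolP.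
by apply/eqP; rewrite eqmodE; apply/asboolP.
Qed.

Lemma pres_classK x : pres_class (repr x) = x.
Proof. exact: reprK. Qed.

Lemma repr_pres_class u : pres_cong (repr (pres_class u)) u.
Proof. by apply/pres_classP; rewrite pres_classK. Qed.

Lemma pres_class_mul u v :
  pres_mul (pres_class u) (pres_class v) = pres_class (u ++ v).
Proof. by apply/pres_classP/pres_cat; exact: repr_pres_class. Qed.

Lemma winv_cat u v : winv (u ++ v) = winv v ++ winv u.
Proof. by rewrite /winv map_cat rev_cat. Qed.

Lemma winvK : involutive winv.
Proof.
move=> u; rewrite /winv map_rev revK -map_comp -[RHS]map_id.
by apply: eq_map => -[i b] /=; rewrite negbK.
Qed.

Lemma pres_mulV u : pres_cong (u ++ winv u) [::].
Proof.
elim: u => [|[i b] u IHu]; first exact: pres_refl.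
rewrite -cat1s winv_cat catA -(catA _ u).
apply: pres_trans (pres_cancel i b); apply: (@pres_cat _ [:: (i, b)]).
  rewrite -[X in pres_cong _ X]cats0.
  by apply: pres_cat IHu; exact: pres_refl.
exact: pres_refl.
Qed.

Lemma pres_Vmul u : pres_cong (winv u ++ u) [::].
Proof. by rewrite -{2}[u]winvK; exact: pres_mulV. Qed.

Lemma pres_cong_inv u v : pres_cong u v -> pres_cong (winv u) (winv v).
Proof.
move=> uv; apply: (@pres_trans _ (winv u ++ (v ++ winv v))).
  rewrite -[X in pres_cong X]cats0; apply: pres_cat; first exact: pres_refl.
  exact/pres_sym/pres_mulV.
rewrite catA -[X in pres_cong _ X]cat0s.
apply: pres_cat; last exact: pres_refl.
apply: pres_trans (pres_Vmul u); apply: pres_cat; first exact: pres_refl.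
exact: pres_sym.
Qed.

Lemma pres_class_inv u : pres_inv (pres_class u) = pres_class (winv u).
Proof. by apply/pres_classP/pres_cong_inv; exact: repr_pres_class. Qed.

Lemma pres_mulA : associative pres_mul.
Proof.
move=> x y z; rewrite -[x]pres_classK -[y]pres_classK -[z]pres_classK.
by rewrite !pres_class_mul catA.
Qed.

Lemma pres_mul1 : left_id pres_one pres_mul.
Proof. by move=> x; rewrite -[x]pres_classK pres_class_mul. Qed.

Lemma pres_1mul : right_id pres_one pres_mul.
Proof. by move=> x; rewrite -[x]pres_classK pres_class_mul cats0. Qed.

Lemma pres_invl : left_inverse pres_one pres_inv pres_mul.
Proof.
move=> x; rewrite -[x]pres_classK pres_class_inv pres_class_mul.
by apply/pres_classP; exact: pres_Vmul.
Qed.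

Lemma pres_invr : right_inverse pres_one pres_inv pres_mul.
Proof.
move=> x; rewrite -[x]pres_classK pres_class_inv pres_class_mul.
by apply/pres_classP; exact: pres_mulV.
Qed.

HB.instance Definition _ := isGroup.Build presented
  pres_mulA pres_mul1 pres_1mul pres_invl pres_invr.

End Presentation.

Section Cyclic.
Variables (B : groupType) (x : B).

Definition cyclic_pred : {pred B} := fun y =>
  `[< exists n : nat, y = (x ^+ n)%g \/ y = (x ^- n)%g >].

Lemma cyclic_predP y :
  reflect (exists m n : nat, y = (x ^+ m / x ^+ n)%g) (y \in cyclic_pred).
Proof.
apply: (iffP (asboolP _)) => [[n [->|->]]|[m [n ->]]].
- by exists n, 0; rewrite divg1.
- by exists 0, n; rewrite div1g.
have [le_nm|/ltnW le_mn] := leqP n m.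
  by exists (m - n)%N; left; rewrite expgnFr.
by exists (n - m)%N; right; rewrite expgnFr // invgF.
Qed.

Lemma cyclic_pred_closed : group_closed cyclic_pred.
Proof.
split=> [|y z /cyclic_predP[m [n ->]] /cyclic_predP[p [q ->]]].
  by apply/cyclic_predP; exists 0, 0; rewrite divg1.
apply/cyclic_predP; exists (m + q)%N, (p + n)%N.
rewrite !expgnDr invgF invgM !mulgA; congr (_ * _)%g.
rewrite -!mulgA; congr (_ * _)%g.
by rewrite -!expVgn; apply: commuteX2; apply/commute_sym; apply/commuteV.
Qed.

HB.instance Definition _ := isMulClosed.Build B cyclic_pred
  (group_closedM cyclic_pred_closed).
HB.instance Definition _ := isMul1Closed.Build B cyclic_pred
  (proj1 cyclic_pred_closed).
HB.instance Definition _ :=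
  isInvClosed.Build B cyclic_pred (group_closedV cyclic_pred_closed).

Definition cyclic : groupClosed B := cyclic_pred.

End Cyclic.

Section Subgroup.
Variables (B : groupType) (H : groupClosed B).

Definition subgrp : Type := {x : B | (H : {pred B}) x}.

HB.instance Definition _ := SubType.on subgrp.
HB.instance Definition _ := Choice.on subgrp.

Lemma subgrp_closed : group_closed (H : {pred B}).
Proof. by split; [exact: gpred1 | move=> u v; exact: gpredF]. Qed.

HB.instance Definition _ :=
  SubChoice_isSubGroup.Build B _ subgrp subgrp_closed.

End Subgroup.

Record left_action (B : groupType) (X : Type) := LeftAction {
  act_fun :> B -> X -> X;
  act1 : forall x, act_fun 1%g x = x;
  actM : forall b c x, act_fun (b * c)%g x = act_fun b (act_fun c x)
}.

Section Cosets.
Variables (B : groupType) (H : groupClosed B).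

(* lcos_eqv x y means x H = y H. *)
Definition lcos_eqv (x y : B) : bool := (x^-1 * y)%g \in H.

Lemma lcos_eqv_equiv : equiv_class_of lcos_eqv.
Proof.
split=> [x|x y|y x z]; rewrite /lcos_eqv ?mulVg ?gpred1 //.
  by rewrite -gpredV invgM invgK.
by move=> xy yz; rewrite -(mulgK y x^-1)%g -mulgA gpredM.
Qed.

Canonical lcos_equiv_rel := EquivRelPack lcos_eqv_equiv.
Canonical lcos_encModRel := defaultEncModRel lcos_eqv.

Definition lcosets : Type := {eq_quot lcos_eqv}.
HB.instance Definition _ : EqQuotient B lcos_eqv lcosets :=
  EqQuotient.on lcosets.
HB.instance Definition _ := Choice.on lcosets.

Definition lcos (b : B) : lcosets := \pi_lcosets b.

Definition lcos_mul (b : B) (C : lcosets) : lcosets := lcos (b * repr C)%g.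

Lemma lcosP x y : lcos x = lcos y <-> (x^-1 * y)%g \in H.
Proof. by split=> [/eqP|xy]; last (apply/eqP); rewrite eqmodE. Qed.

Lemma lcosK C : lcos (repr C) = C.
Proof. exact: reprK. Qed.

Lemma lcos_mulE b x : lcos_mul b (lcos x) = lcos (b * x)%g.
Proof.
by apply/lcosP; rewrite invgM mulgA mulgVK; apply/lcosP; rewrite lcosK.
Qed.

Lemma lcos_mul1 C : lcos_mul 1%g C = C.
Proof. by rewrite -[C]lcosK lcos_mulE mul1g. Qed.

Lemma lcos_mulM b c C : lcos_mul (b * c)%g C = lcos_mul b (lcos_mul c C).
Proof. by rewrite -[C]lcosK !lcos_mulE mulgA. Qed.

Definition lcos_action : left_action B lcosets :=
  LeftAction lcos_mul1 lcos_mulM.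

End Cosets.

(* {malg A[X]} is the group of finitely supported functions X -> A, and
   << a *g x >> is the function with value a at x and 0 elsewhere. *)
Section Pushforward.
Variables (X Y : choiceType) (A : zmodType) (f : X -> Y).

Definition mpush (u : {malg A[X]}) : {malg A[Y]} :=
  \sum_(x <- msupp u) << u@_x *g f x >>.

Lemma mpushEw (d : {fset X}) u : (msupp u `<=` d)%fset ->
  mpush u = \sum_(x <- d) << u@_x *g f x >>.
Proof.
move=> le_d; rewrite /mpush (big_fset_incl _ le_d) //= => x _ /mcoeff_outdom ->.
by rewrite monalgU0.
Qed.

Lemma mpush_is_zmod_morphism : zmod_morphism mpush.
Proof.
move=> u v; rewrite (mpushEw (msuppB_le u v)).
rewrite (mpushEw (fsubsetUl (msupp u) (msupp v))).
rewrite (mpushEw (fsubsetUr (msupp u) (msupp v))).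
by rewrite -sumrB; apply: eq_bigr => x _; rewrite mcoeffB monalgUB.
Qed.

HB.instance Definition _ :=
  GRing.isZmodMorphism.Build {malg A[X]} {malg A[Y]} mpush
    mpush_is_zmod_morphism.

Lemma mpushU a x : mpush << a *g x >> = << a *g f x >>.
Proof. by rewrite (mpushEw msuppU_le) big_seq_fset1 mcoeffUU. Qed.

End Pushforward.

Lemma mpush_id (X : choiceType) (A : zmodType) (f : X -> X) (u : {malg A[X]}) :
  f =1 id -> mpush f u = u.
Proof.
by move=> fE; rewrite [RHS]monalgE; apply: eq_bigr => x _; rewrite fE.
Qed.

Lemma mpush_comp (X Y Z : choiceType) (A : zmodType) (f : X -> Y) (g : Y -> Z)
    (h : X -> Z) (u : {malg A[X]}) :
  (forall x, g (f x) = h x) -> mpush g (mpush f u) = mpush h u.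
Proof.
move=> ghE; rewrite [mpush f u]/mpush raddf_sum /=; apply: eq_bigr => x _.
by rewrite mpushU ghE.
Qed.

(* A wr_X B: the pair (u, b) stands for the product u b in AX >| B, so that
   (u b) (v c) = (u + b v b^-1) (b c) with b (a x) b^-1 = a (b * x). *)
Definition wreath (A : zmodType) (B : groupType) (X : choiceType)
  (to : left_action B X) : Type := ({malg A[X]} * B)%type.

Section Wreath.
Variables (A : zmodType) (B : groupType) (X : choiceType).
Variable to : left_action B X.
Local Notation W := (wreath A to).

HB.instance Definition _ := Choice.on W.

Implicit Types p q r : W.

Definition wr_one : W := (0, 1%g).
Definition wr_mul p q : W := (p.1 + mpush (to p.2) q.1, (p.2 * q.2)%g).
Definition wr_inv p : W := (- mpush (to p.2^-1%g) p.1, p.2^-1%g).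

Lemma wr_mulA : associative wr_mul.
Proof.
move=> p q r; rewrite /wr_mul /= mulgA raddfD /= addrA; congr (_ + _, _).
by apply: mpush_comp => x; rewrite actM.
Qed.

Lemma wr_mul1 : left_id wr_one wr_mul.
Proof.
by case=> u b; rewrite /wr_mul /= add0r mul1g mpush_id // => x; rewrite act1.
Qed.

Lemma wr_1mul : right_id wr_one wr_mul.
Proof. by case=> u b; rewrite /wr_mul /= raddf0 addr0 mulg1. Qed.

Lemma wr_invl : left_inverse wr_one wr_inv wr_mul.
Proof. by case=> u b; rewrite /wr_mul /= addNr mulVg. Qed.

Lemma wr_invr : right_inverse wr_one wr_inv wr_mul.
Proof.
case=> u b; rewrite /wr_mul /= raddfN /= mulgV.
rewrite (@mpush_comp _ _ _ _ _ _ id) => [|x]; first by rewrite mpush_id // subrr.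
by rewrite -actM mulgV act1.
Qed.

HB.instance Definition _ := isGroup.Build W
  wr_mulA wr_mul1 wr_1mul wr_invl wr_invr.

End Wreath.

Section GroupRing.
Variables (K : nzRingType) (B : groupType).

Definition group_ring : Type := {malg K[B]}.
HB.instance Definition _ := GRing.Zmodule.on group_ring.

Implicit Types u v w : group_ring.

Definition gr_one : group_ring := << 1 *g 1%g >>.

Definition gr_mul u v : group_ring :=
  \sum_(b <- msupp u) \sum_(c <- msupp v) << u@_b * v@_c *g (b * c)%g >>.

Lemma gr_mulEw (d1 d2 : {fset B}) u v :
  (msupp u `<=` d1)%fset -> (msupp v `<=` d2)%fset ->
  gr_mul u v =
    \sum_(b <- d1) \sum_(c <- d2) << u@_b * v@_c *g (b * c)%g >>.
Proof.
move=> le_d1 le_d2; rewrite /gr_mul (big_fset_incl _ le_d1) /=.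
  apply/eq_bigr=> b _; apply/big_fset_incl => // c _ /mcoeff_outdom ->.
  by rewrite mulr0 monalgU0.
move=> b _ /mcoeff_outdom ub0.
by rewrite big1 => // c _; rewrite ub0 mul0r monalgU0.
Qed.

Lemma gr_mulDl : left_distributive gr_mul +%R.
Proof.
move=> u v w.
rewrite (gr_mulEw (msuppD_le u v) (fsubset_refl _)).
rewrite (gr_mulEw (fsubsetUl (msupp u) (msupp v)) (fsubset_refl _)).
rewrite (gr_mulEw (fsubsetUr (msupp u) (msupp v)) (fsubset_refl _)).
rewrite -big_split /=; apply/eq_bigr=> b _.
rewrite -big_split /=; apply/eq_bigr=> c _.
by rewrite mcoeffD mulrDl monalgUD.
Qed.

Lemma gr_mulDr : right_distributive gr_mul +%R.
Proof.
move=> u v w.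
rewrite (gr_mulEw (fsubset_refl _) (msuppD_le v w)).
rewrite (gr_mulEw (fsubset_refl _) (fsubsetUl (msupp v) (msupp w))).
rewrite (gr_mulEw (fsubset_refl _) (fsubsetUr (msupp v) (msupp w))).
rewrite -big_split /=; apply/eq_bigr=> b _.
rewrite -big_split /=; apply/eq_bigr=> c _.
by rewrite mcoeffD mulrDr monalgUD.
Qed.

Lemma gr_mul0l : left_zero 0 gr_mul.
Proof. by move=> u; rewrite /gr_mul msupp0 big_seq_fset0. Qed.

Lemma gr_mul0r : right_zero 0 gr_mul.
Proof.
by move=> u; rewrite /gr_mul big1 // => b _; rewrite msupp0 big_seq_fset0.
Qed.

Lemma gr_mulUU x y b c :
  gr_mul << x *g b >> << y *g c >> = << x * y *g (b * c)%g >>.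
Proof. by rewrite (gr_mulEw msuppU_le msuppU_le) !big_seq_fset1 !mcoeffUU. Qed.

Lemma gr_mul_suml (I : Type) (s : seq I) (F : I -> group_ring) v :
  gr_mul (\sum_(i <- s) F i) v = \sum_(i <- s) gr_mul (F i) v.
Proof.
exact: (big_morph (gr_mul^~ v) (fun _ _ => gr_mulDl _ _ _) (gr_mul0l v)).
Qed.

Lemma gr_mul_sumr (I : Type) (s : seq I) (F : I -> group_ring) u :
  gr_mul u (\sum_(i <- s) F i) = \sum_(i <- s) gr_mul u (F i).
Proof.
exact: (big_morph (gr_mul u) (fun _ _ => gr_mulDr _ _ _) (gr_mul0r u)).
Qed.

Lemma gr_mulA : associative gr_mul.
Proof.
move=> u v w; rewrite [u]monalgE [v]monalgE [w]monalgE.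
rewrite !(gr_mul_suml (msupp u)).
apply: eq_bigr => b _; rewrite (gr_mul_suml (msupp v)).
rewrite !(gr_mul_sumr (msupp v)) (gr_mul_suml (msupp v)).
apply: eq_bigr => c _; rewrite !(gr_mul_sumr (msupp w)).
apply: eq_bigr => d _.
by rewrite !gr_mulUU mulrA mulgA.
Qed.

Lemma gr_mul1 : left_id gr_one gr_mul.
Proof.
move=> u; rewrite [u]monalgE gr_mul_sumr; apply: eq_bigr => b _.
by rewrite gr_mulUU mul1r mul1g.
Qed.

Lemma gr_1mul : right_id gr_one gr_mul.
Proof.
move=> u; rewrite [u]monalgE gr_mul_suml; apply: eq_bigr => b _.
by rewrite gr_mulUU mulr1 mulg1.
Qed.

Lemma gr_one_neq0 : gr_one != 0.
Proof. by rewrite monalgU_eq0 oner_eq0. Qed.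

HB.instance Definition _ := GRing.Zmodule_isNzRing.Build group_ring
  gr_mulA gr_mul1 gr_1mul gr_mulDl gr_mulDr gr_one_neq0.

End GroupRing.

Section GroupRingMorphisms.
Variables (K : nzRingType) (B : groupType) (H : groupClosed B).

Definition gr_incl (u : group_ring K (subgrp H)) : group_ring K B :=
  mpush val u.

Lemma gr_incl_is_zmod_morphism : zmod_morphism gr_incl.
Proof. exact: mpush_is_zmod_morphism. Qed.

HB.instance Definition _ := GRing.isZmodMorphism.Build
  (group_ring K (subgrp H)) (group_ring K B) gr_incl gr_incl_is_zmod_morphism.

Lemma gr_incl_is_monoid_morphism : monoid_morphism gr_incl.
Proof.
split=> [|u v]; first exact: mpushU.
rewrite [u]monalgE [v]monalgE mulr_suml !raddf_sum mulr_suml.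
apply: eq_bigr => b _; rewrite !mulr_sumr raddf_sum; apply: eq_bigr => c _.
by rewrite /GRing.mul /= gr_mulUU /gr_incl !mpushU gr_mulUU.
Qed.

HB.instance Definition _ := GRing.isMonoidMorphism.Build
  (group_ring K (subgrp H)) (group_ring K B) gr_incl
  gr_incl_is_monoid_morphism.

End GroupRingMorphisms.

(* B is kept as a parameter because the K B-module structure on K depends on
   it: an element of K B acts through its augmentation. *)
Definition trivial_module (K : nzRingType) (B : groupType) : Type := K.

Section Augmentation.
Variables (K : nzRingType) (B : groupType).
Local Notation triv := (trivial_module K B).

Definition gr_aug (u : group_ring K B) : K := \sum_(b <- msupp u) u@_b.

Lemma gr_augEw (d : {fset B}) (u : group_ring K B) : (msupp u `<=` d)%fset ->
  gr_aug u = \sum_(b <- d) u@_b.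
Proof.
by move=> le_d; rewrite /gr_aug (big_fset_incl _ le_d) //= => b _ /mcoeff_outdom.
Qed.

Lemma gr_aug_is_zmod_morphism : zmod_morphism gr_aug.
Proof.
move=> u v; rewrite (gr_augEw (msuppB_le u v)).
rewrite (gr_augEw (fsubsetUl (msupp u) (msupp v))).
rewrite (gr_augEw (fsubsetUr (msupp u) (msupp v))).
by rewrite -sumrB; apply: eq_bigr => b _; rewrite mcoeffB.
Qed.

HB.instance Definition _ := GRing.isZmodMorphism.Build
  (group_ring K B) K gr_aug gr_aug_is_zmod_morphism.

Lemma gr_augU a b : gr_aug << a *g b >> = a.
Proof. by rewrite (gr_augEw msuppU_le) big_seq_fset1 mcoeffUU. Qed.

Lemma gr_aug_is_monoid_morphism : monoid_morphism gr_aug.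
Proof.
split=> [|u v]; first exact: gr_augU.
rewrite [u]monalgE [v]monalgE mulr_suml !raddf_sum mulr_suml.
apply: eq_bigr => b _; rewrite !mulr_sumr raddf_sum; apply: eq_bigr => c _.
by rewrite [in LHS]/GRing.mul /= gr_mulUU !gr_augU.
Qed.

HB.instance Definition _ := GRing.isMonoidMorphism.Build
  (group_ring K B) K gr_aug gr_aug_is_monoid_morphism.

HB.instance Definition _ := GRing.Zmodule.on triv.

Definition triv_scale (u : group_ring K B) (x : triv) :
  triv := gr_aug u * (x : K).

Lemma triv_scaleA u v x : triv_scale u (triv_scale v x) = triv_scale (u * v) x.
Proof. by rewrite /triv_scale rmorphM mulrA. Qed.

Lemma triv_scale1 : left_id 1 triv_scale.
Proof. by move=> x; rewrite /triv_scale rmorph1 mul1r. Qed.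

Lemma triv_scaleDr : right_distributive triv_scale +%R.
Proof. by move=> u x y; rewrite /triv_scale mulrDr. Qed.

Lemma triv_scaleDl x : {morph triv_scale^~ x : u v / u + v}.
Proof. by move=> u v; rewrite /triv_scale raddfD mulrDl. Qed.

HB.instance Definition _ := GRing.Zmodule_isLmodule.Build
  (group_ring K B) triv
  triv_scaleA triv_scale1 triv_scaleDr triv_scaleDl.

End Augmentation.

(* S (x)_R N, with S a right R-module through phi: the quotient of the free
   abelian group on S * N by the subgroup generated by the usual relations. *)
Section ExtensionOfScalars.
Variables (R S : nzRingType) (phi : {rmorphism R -> S}) (N : lmodType R).

Definition tens_free : Type := {malg int[(S * N)%type]}.
HB.instance Definition _ := GRing.Zmodule.on tens_free.

Inductive tens_rel : tens_free -> Prop :=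
| tens_rel0 : tens_rel 0
| tens_relB u v : tens_rel u -> tens_rel v -> tens_rel (u - v)
| tens_relDl s s' n :
    tens_rel (<< (s + s', n) >> - << (s, n) >> - << (s', n) >>)
| tens_relDr s n n' :
    tens_rel (<< (s, n + n') >> - << (s, n) >> - << (s, n') >>)
| tens_relZ s r n : tens_rel (<< (s * phi r, n) >> - << (s, r *: n) >>).

Definition tens_relb : {pred tens_free} := fun u => `[< tens_rel u >].

Lemma tens_relb_closed : zmod_closed tens_relb.
Proof.
split=> [|u v /asboolP ru /asboolP rv]; apply/asboolP; first exact: tens_rel0.
exact: tens_relB.
Qed.

HB.instance Definition _ :=
  GRing.isZmodClosed.Build tens_free tens_relb tens_relb_closed.

Definition ext_scalars : Type := Quotient.quot (tens_relb : zmodClosed _).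
HB.instance Definition _ := GRing.Zmodule.on ext_scalars.

Definition tens_class (u : tens_free) : ext_scalars :=
  \pi_(Quotient.quot (tens_relb : zmodClosed _)) u.

Definition tens (s : S) (n : N) : ext_scalars := tens_class << (s, n) >>.

Definition tens_free_scale (a : S) : tens_free -> tens_free :=
  mpush (fun p => (a * p.1, p.2)).

Lemma tens_free_scale_is_zmod_morphism a : zmod_morphism (tens_free_scale a).
Proof. exact: mpush_is_zmod_morphism. Qed.

HB.instance Definition _ a := GRing.isZmodMorphism.Build tens_free tens_free
  (tens_free_scale a) (tens_free_scale_is_zmod_morphism a).

Lemma tens_free_scaleU a s n :
  tens_free_scale a << (s, n) >> = << (a * s, n) >>.
Proof. exact: mpushU. Qed.

Lemma tens_class_is_zmod_morphism : zmod_morphism tens_class.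
Proof. by move=> u v; rewrite /tens_class raddfB. Qed.

HB.instance Definition _ := GRing.isZmodMorphism.Build tens_free ext_scalars
  tens_class tens_class_is_zmod_morphism.

Lemma tens_classP u v : tens_class u = tens_class v <-> tens_rel (u - v).
Proof.
split=> [/eqP|uv]; first by rewrite -Quotient.idealrBE => /asboolP.
by apply/eqP; rewrite -Quotient.idealrBE; apply/asboolP.
Qed.

Lemma tens_classK x : tens_class (repr x) = x.
Proof. exact: reprK. Qed.

Lemma tens_class0 u : tens_rel u -> tens_class u = 0.
Proof.
by move=> ru; rewrite -(raddf0 tens_class); apply/tens_classP; rewrite subr0.
Qed.

Lemma tens_ind (P : ext_scalars -> Prop) :
    (forall s n, P (tens s n)) -> (forall x y, P x -> P y -> P (x - y)) ->
  forall x, P x.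
Proof.
move=> Ptens PB x; have P0 : P 0 by rewrite -(subrr (tens 0 0)); apply: PB.
have PN y : P y -> P (- y) by rewrite -sub0r; exact: PB.
have PD y z : P y -> P z -> P (y + z) by move=> Py /PN /(PB _ _ Py); rewrite opprK.
rewrite -[x]tens_classK [repr x]monalgE raddf_sum.
elim/big_ind: _ => // -[s n] _.
have UE (k : nat) : << k%:Z *g (s, n) >> = << (s, n) >> *+ k :> tens_free.
  by rewrite -monalgUMn natz.
have PU (k : nat) : P (tens_class << k%:Z *g (s, n) >>).
  rewrite UE raddfMn; elim: k => [|k IHk]; first by rewrite mulr0n.
  by rewrite mulrS; apply: PD => //; exact: Ptens.
case: (_@__) => k; first exact: PU.
by rewrite NegzE monalgUN raddfN; apply: PN; exact: PU.
Qed.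

Lemma tensDl s s' n : tens (s + s') n = tens s n + tens s' n.
Proof.
apply/eqP; rewrite -subr_eq0 opprD addrA /tens -!raddfB /= tens_class0 //.
exact: tens_relDl.
Qed.

Lemma tensDr s n n' : tens s (n + n') = tens s n + tens s n'.
Proof.
apply/eqP; rewrite -subr_eq0 opprD addrA /tens -!raddfB /= tens_class0 //.
exact: tens_relDr.
Qed.

Lemma tensZ s r n : tens (s * phi r) n = tens s (r *: n).
Proof. by apply/tens_classP; exact: tens_relZ. Qed.

Lemma tens_rel_scale a u : tens_rel u -> tens_rel (tens_free_scale a u).
Proof.
elim=> [|v w _ rv _ rw|s s' n|s n n'|s r n]; rewrite ?raddfB /= ?tens_free_scaleU.
- by rewrite raddf0; exact: tens_rel0.
- exact: tens_relB.
- by rewrite mulrDr; exact: tens_relDl.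
- exact: tens_relDr.
- by rewrite mulrA; exact: tens_relZ.
Qed.

Definition tens_scale (a : S) (x : ext_scalars) : ext_scalars :=
  tens_class (tens_free_scale a (repr x)).

Lemma tens_scale_class a u :
  tens_scale a (tens_class u) = tens_class (tens_free_scale a u).
Proof.
apply/tens_classP; rewrite -raddfB; apply: tens_rel_scale.
by apply/tens_classP; rewrite tens_classK.
Qed.

Lemma tens_scaleE a s n : tens_scale a (tens s n) = tens (a * s) n.
Proof. by rewrite tens_scale_class tens_free_scaleU. Qed.

Lemma tens_scaleB a x y : tens_scale a (x - y) = tens_scale a x - tens_scale a y.
Proof.
by rewrite -[x]tens_classK -[y]tens_classK -raddfB !tens_scale_class !raddfB.
Qed.

Lemma tens_scaleA a b x : tens_scale a (tens_scale b x) = tens_scale (a * b) x.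
Proof.
elim/tens_ind: x => [s n|x y IHx IHy]; first by rewrite !tens_scaleE mulrA.
by rewrite !tens_scaleB IHx IHy.
Qed.

Lemma tens_scale1 : left_id 1 tens_scale.
Proof.
elim/tens_ind => [s n|x y IHx IHy]; first by rewrite tens_scaleE mul1r.
by rewrite tens_scaleB IHx IHy.
Qed.

Lemma tens_scaleDr : right_distributive tens_scale +%R.
Proof.
move=> a x y; have Z : tens_scale a 0 = 0.
  by rewrite -[X in tens_scale a X](subrr 0) tens_scaleB subrr.
by rewrite -{1}[y]opprK tens_scaleB -(sub0r y) tens_scaleB Z sub0r opprK.
Qed.

Lemma tens_scaleDl x : {morph tens_scale^~ x : a b / a + b}.
Proof.
move=> a b; elim/tens_ind: x => [s n|x y IHx IHy].
  by rewrite !tens_scaleE mulrDl tensDl.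
by rewrite !tens_scaleB IHx IHy opprD addrACA.
Qed.

HB.instance Definition _ := GRing.Zmodule_isLmodule.Build S ext_scalars
  tens_scaleA tens_scale1 tens_scaleDr tens_scaleDl.

End ExtensionOfScalars.

(* Ind_H^B(K) = K B (x)_(K H) K. *)
Definition induced (K : nzRingType) (B : groupType) (H : groupClosed B) :
    lmodType (group_ring K B) :=
  ext_scalars (@gr_incl K B H) (trivial_module K (subgrp H)).

Section EndomorphismRing.
Variables (R : pzRingType) (M : lmodType R).

Definition endring : Type := {f : M -> M | `[< linear f >]}.
HB.instance Definition _ := SubType.on endring.
HB.instance Definition _ := Choice.on endring.

Implicit Types f g h : endring.

Definition endfun f : M -> M := val f.

Lemma endring_linear f : linear (endfun f).
Proof. exact/asboolP/(valP f). Qed.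

HB.instance Definition _ f :=
  GRing.isLinear.Build R M M *:%R (endfun f) (endring_linear f).

Definition end_of (f : {linear M -> M}) : endring :=
  Sub (f : M -> M) (introT (asboolP _) (linearP f)).

Lemma end_ofE (f : {linear M -> M}) x : endfun (end_of f) x = f x.
Proof. by []. Qed.

Lemma endringP f g : endfun f =1 endfun g -> f = g.
Proof. by move=> fg; apply/val_inj/funext. Qed.

Definition end_zero := end_of \0.
Definition end_opp f := end_of (\- endfun f).
Definition end_add f g := end_of (endfun f \+ endfun g).
Definition end_one := end_of idfun.
Definition end_mul f g := end_of (endfun f \o endfun g).

Lemma end_addA : associative end_add.
Proof. by move=> f g h; apply: endringP => x; exact: addrA. Qed.

Lemma end_addC : commutative end_add.
Proof. by move=> f g; apply: endringP => x; exact: addrC. Qed.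

Lemma end_add0 : left_id end_zero end_add.
Proof. by move=> f; apply: endringP => x; exact: add0r. Qed.

Lemma end_addN : left_inverse end_zero end_opp end_add.
Proof. by move=> f; apply: endringP => x; exact: addNr. Qed.

HB.instance Definition _ :=
  GRing.isZmodule.Build endring end_addA end_addC end_add0 end_addN.

Lemma end_mulA : associative end_mul.
Proof. by move=> f g h; apply: endringP. Qed.

Lemma end_mul1 : left_id end_one end_mul.
Proof. by move=> f; apply: endringP. Qed.

Lemma end_1mul : right_id end_one end_mul.
Proof. by move=> f; apply: endringP. Qed.

Lemma end_mulDl : left_distributive end_mul +%R.
Proof. by move=> f g h; apply: endringP. Qed.

Lemma end_mulDr : right_distributive end_mul +%R.
Proof. by move=> f g h; apply: endringP => x; exact: raddfD. Qed.

HB.instance Definition _ := GRing.Zmodule_isPzRing.Build endring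
  end_mulA end_mul1 end_1mul end_mulDl end_mulDr.

End EndomorphismRing.

(* The group B = < h0, t | t^-1 h0 t = h0^(m+1) >; the generator h0 is the
   letter false and t the letter true. *)
Definition bs_rels (m : nat) : seq (word bool * word bool) :=
  [:: ([:: (true, true); (false, false); (true, false)],
       nseq m.+1 (false, false))].

Definition bs (m : nat) : groupType := presented (bs_rels m).
Definition bs_h0 (m : nat) : bs m := pres_gen (bs_rels m) false.
Definition bs_t (m : nat) : bs m := pres_gen (bs_rels m) true.

Lemma bs_relation m :
  ((bs_t m)^-1 * bs_h0 m * bs_t m = bs_h0 m ^+ m.+1)%g.
Proof.
pose cl : word bool -> bs m := @pres_class _ (bs_rels m).
have mulE u v : (cl u * cl v)%g = cl (u ++ v) by exact: pres_class_mul.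
have powE n : (bs_h0 m ^+ n)%g = cl (nseq n (false, false)).
  by elim: n => // n IHn; rewrite expgS IHn; exact: mulE.
have -> : ((bs_t m)^-1)%g = cl [:: (true, true)] by exact: pres_class_inv.
have -> : bs_h0 m = cl [:: (false, false)] by [].
have -> : bs_t m = cl [:: (true, false)] by [].
rewrite powE (mulE [:: (true, true)] [:: (false, false)]) mulE; apply/pres_classP.
by have /pres_rel := mem_head ([:: (true, true); (false, false); (true, false)],
  nseq m.+1 (false, false)) [::].
Qed.

Definition bs_H (m : nat) : groupClosed (bs m) := cyclic (bs_h0 m).

(* Main.v *)
(* Put n = m + 1. Since t^-1 H t is contained in H, the map b H |-> b t H of B/H
   is well defined; it is B-equivariant and surjective, and it is not injective
   because c = t h0 t^-1 is not in H while c t H = t h0 H = t H. It induces a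
   surjective non-injective endomorphism f of Ind_H^B(K), and also one of
   A wr_X B for every nontrivial A, so G is not Hopfian. When n is invertible in
   K, averaging over the n preimages of a coset gives a right inverse of f,
   which cannot be a left inverse.

   The group B acts on the rationals by h0 : x |-> x + 1 and t : x |-> x / n, and
   its elements are t^p x t^-q with x in H. Comparing slopes, a surjective
   endomorphism f of B maps t to an element of slope different from 1 and h0 to a
   conjugate of some y in H. Here y <> 1, as otherwise B would be commutative, so
   f h0 has infinite order; and an element t^p x t^-q of the kernel has p = q by
   slopes, hence x = 1. *)
Require Import Defs.
From HB Require Import structures.
From mathcomp Require Import all_boot all_order all_algebra.
From mathcomp Require Import finmap boolp ring.
From mathcomp.multinomials Require Import monalg.

Set Implicit Arguments.
Unset Strict Implicit.
Unset Printing Implicit Defensive.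

Import GRing.Theory Order.TTheory Num.Theory.
Local Open Scope ring_scope.

(** * Hopfian groups, cyclic subgroups and presented groups *)

(** A multiplicative map between groups preserves 1 by cancellation, and it is injective once its
    kernel is trivial. *)
Lemma hopfianP (G : groupType) :
  hopfian G <-> forall f : UMagmaMorphism.type G G,
    (forall y, exists x, f x = y) -> forall x, f x = 1%g -> x = 1%g.
Proof.
split=> hG f f_surj => [x fx|].
  by apply: (bij_inj (hG f f_surj)); rewrite fx gmulf1.
have f_morph : monoid.monoid_morphism f.
  split=> [|x y]; last exact: gmulfM.
  by apply: (@mulgI _ (f 1%g)); rewrite -gmulfM !mulg1.
pose fM := isUMagmaMorphism.Build G G f f_morph.
pose F : UMagmaMorphism.type G G := HB.pack (f : G -> G) fM.
have f_inj : injective f := gmulf_inj (f := F) (hG F f_surj).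
have [g gK] := choice f_surj.
by exists g => // x; apply: f_inj; rewrite gK.
Qed.

Lemma cyclicX (B : groupType) (x : B) k : (x ^+ k)%g \in cyclic x.
Proof. by apply/asboolP; exists k; left. Qed.

Lemma cyclic_id (B : groupType) (x : B) : x \in cyclic x.
Proof. exact: (cyclicX x 1). Qed.

Lemma presented_ind (I : choiceType) (rels : seq (word I * word I))
    (P : presented rels -> Prop) :
    P 1%g ->
    (forall i x, P x -> P (pres_gen rels i * x)%g) ->
    (forall i x, P x -> P ((pres_gen rels i)^-1 * x)%g) ->
  forall x, P x.
Proof.
move=> P1 Pg Pv x; rewrite -[x]pres_classK.
elim: (repr x) => [|[i b] u IHu]; first exact: P1.
have -> : pres_class rels ((i, b) :: u) =
    (pres_class rels [:: (i, b)] * pres_class rels u)%g.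
  by rewrite [RHS]pres_class_mul.
case: b; last exact: Pg.
have -> : pres_class rels [:: (i, true)] = (pres_gen rels i)^-1%g.
  by rewrite [RHS]pres_class_inv.
exact: Pv.
Qed.

(** * The affine action of B on the rationals and normal forms in B *)

Section BaumslagSolitar.
Variable m : nat.
Local Notation h := (bs_h0 m).
Local Notation t := (bs_t m).
Local Notation H := (bs_H m).

Definition bs_letter (l : bool * bool) (x : rat) : rat :=
  match l with
  | (false, false) => x + 1
  | (false, true) => x - 1
  | (true, false) => x / m.+1%:R
  | (true, true) => x * m.+1%:R
  end.

Definition bs_word (w : word bool) (x : rat) : rat := foldr bs_letter x w.

Definition bs_act (b : bs m) : rat -> rat := bs_word (repr b).

(** Both sides of the defining relation act as x |-> x + n, where n = m + 1. *)
Lemma bs_word_cong u v : pres_cong (bs_rels m) u v -> bs_word u =1 bs_word v.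
Proof.
have n0 : m.+1%:R != 0 :> rat by rewrite pnatr_eq0.
elim=> [[] []|r r_in|u1 u2 v1 v2 _ IHu _ IHv|w|w1 w2 _ IH|
  w1 w2 w3 _ IH1 _ IH2] x //=.
- by rewrite mulfVK.
- by rewrite mulfK.
- by rewrite addrK.
- by rewrite subrK.
- move: r_in; rewrite mem_seq1 => /eqP-> /=; rewrite mulrDl mulfVK // mul1r.
  have -> : bs_word (nseq m (false, false)) x = x + m%:R.
    by elim: (m) => [|k /= ->]; rewrite ?addr0 // -addrA natr1.
  by rewrite -addrA natr1.
- by rewrite /bs_word !foldr_cat -!/(bs_word _ _) IHv IHu.
- by rewrite IH1.
Qed.

Lemma bs_act_class u : bs_act (pres_class _ u) =1 bs_word u.
Proof. exact/bs_word_cong/repr_pres_class. Qed.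

Lemma bs_act1 x : bs_act 1%g x = x.
Proof. exact: (bs_act_class [::]). Qed.

Lemma bs_actM b c x : bs_act (b * c)%g x = bs_act b (bs_act c x).
Proof. by rewrite bs_act_class /bs_word foldr_cat. Qed.

Lemma bs_act_h x : bs_act h x = x + 1.
Proof. exact: bs_act_class. Qed.

Lemma bs_act_t x : bs_act t x = x / m.+1%:R.
Proof. exact: bs_act_class. Qed.

Lemma bs_actV b x : bs_act b (bs_act b^-1%g x) = x.
Proof. by rewrite -bs_actM mulgV bs_act1. Qed.

Lemma bs_act_tV x : bs_act t^-1%g x = x * m.+1%:R.
Proof.
have n0 : m.+1%:R != 0 :> rat by rewrite pnatr_eq0.
by apply: (mulIf (invr_neq0 n0)); rewrite mulfK // -bs_act_t bs_actV.
Qed.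

Lemma bs_act_hX k x : bs_act (h ^+ k)%g x = x + k%:R.
Proof.
elim: k => [|k IHk]; first by rewrite expg0 bs_act1 addr0.
by rewrite expgS bs_actM IHk bs_act_h -addrA natr1.
Qed.

Lemma bs_act_hXV k x : bs_act (h ^- k)%g x = x - k%:R.
Proof. by apply: (addIr k%:R); rewrite subrK -bs_act_hX bs_actV. Qed.

(** The linear coefficient of the affine map by which [b] acts. *)
Definition bs_slope (b : bs m) : rat := bs_act b 1 - bs_act b 0.

Lemma bs_actE b x : bs_act b x = bs_slope b * x + bs_act b 0.
Proof.
rewrite /bs_slope /bs_act; elim: (repr b) x => [|l w IHw] x.
  by rewrite /= [X in (X * _ + _)]subr0 mul1r [RHS]addr0.
rewrite /= [in LHS]IHw; move: (bs_word w 1) (bs_word w 0) => u v.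
case: l => -[] []; rewrite /=; move: (m.+1%:R : rat) => n; ring.
Qed.

Lemma bs_slopeM b c : bs_slope (b * c)%g = bs_slope b * bs_slope c.
Proof.
rewrite {1}/bs_slope !bs_actM (bs_actE b (bs_act c 1)) (bs_actE b (bs_act c 0)).
by rewrite opprD addrACA subrr addr0 -mulrBr. Qed.

Lemma bs_slope1 : bs_slope 1%g = 1.
Proof. by rewrite /bs_slope !bs_act1 subr0. Qed.

Lemma bs_slopeX b k : bs_slope (b ^+ k)%g = bs_slope b ^+ k.
Proof.
by elim: k => [|k IHk]; rewrite ?expg0 ?bs_slope1 // expgS bs_slopeM IHk exprS.
Qed.

Lemma bs_slope_t : bs_slope t = m.+1%:R^-1.
Proof. by rewrite /bs_slope !bs_act_t mul0r subr0 mul1r. Qed.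

Lemma bs_slope_h : bs_slope h = 1.
Proof. by rewrite /bs_slope !bs_act_h add0r addrK. Qed.

Lemma bs_slope_neq0 b : bs_slope b != 0.
Proof.
apply/eqP=> b0; have := bs_slopeM b b^-1%g; rewrite mulgV bs_slope1 b0 mul0r.
by apply/eqP; rewrite oner_eq0.
Qed.

Lemma bs_slopeV b : bs_slope b^-1%g = (bs_slope b)^-1.
Proof.
apply: (mulfI (bs_slope_neq0 b)).
by rewrite -bs_slopeM mulgV bs_slope1 divff ?bs_slope_neq0.
Qed.

Lemma bs_slope_gt0 b : 0 < bs_slope b.
Proof.
have t0 : 0 < bs_slope t by rewrite bs_slope_t invr_gt0 ltr0Sn.
elim/presented_ind: b => [|[] x IHx|[] x IHx];
  rewrite ?bs_slope1 ?bs_slopeM ?bs_slopeV //.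
- by apply: mulr_gt0 IHx; exact: t0.
- by apply: mulr_gt0 IHx; rewrite bs_slope_h.
- by apply: mulr_gt0 IHx; rewrite invr_gt0; exact: t0.
- by apply: mulr_gt0 IHx; rewrite bs_slope_h invr1.
Qed.

Lemma bs_slope_H x : x \in H -> bs_slope x = 1.
Proof.
by case/asboolP=> k [|] ->;
  rewrite ?bs_slopeV bs_slopeX bs_slope_h expr1n ?invr1.
Qed.

Lemma bs_h0_tconj : (h ^ t = h ^+ m.+1)%g.
Proof. by rewrite conjgE mulgA bs_relation. Qed.

Lemma bs_H_tconj x : x \in H -> (x ^ t = x ^+ m.+1)%g.
Proof.
case/asboolP=> k [|] ->.
  by rewrite conjXg bs_h0_tconj expgnAC.
by rewrite conjVg conjXg bs_h0_tconj -!expVgn expgnAC.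
Qed.

Lemma bs_H_mul_t x : x \in H -> (x * t = t * x ^+ m.+1)%g.
Proof. by move=> /bs_H_tconj <-; rewrite -conjgC. Qed.

Lemma bs_H_mul_tX p x : x \in H -> (x * t ^+ p = t ^+ p * x ^+ (m.+1 ^ p))%g.
Proof.
move=> xH; elim: p => [|p IHp]; first by rewrite expg0 mulg1 mul1g expg1.
rewrite expgSr mulgA IHp -!mulgA bs_H_mul_t ?gpredXn //.
by rewrite -expgnA expnSr.
Qed.

(** Induction on left multiplication by a letter: h0 and its inverse cross t^p by becoming their
    n^p-th powers, and when p = 0 the letter t^-1 crosses x by t^-1 x = x^n t^-1, which raises q. *)
Lemma bs_normal_form b :
  exists p q : nat, exists2 x, x \in H & b = (t ^+ p * x * t ^- q)%g.
Proof.
have hH : h \in H by exact: cyclic_id.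
elim/presented_ind: b => [|[] _ [p [q [x xH ->]]]|[] _ [p [q [x xH ->]]]].
- by exists 0, 0, 1%g; rewrite ?gpred1 // expg0 !mul1g invg1.
- by exists p.+1, q, x; rewrite // expgS -!mulgA.
- exists p, q, (h ^+ (m.+1 ^ p) * x)%g; first by rewrite gpredM // gpredXn.
  by rewrite !mulgA -(bs_H_mul_tX p hH).
- case: p => [|p]; last by exists p, q, x; rewrite // expgS -!mulgA mulKg.
  exists 0, q.+1, (x ^+ m.+1)%g; first by rewrite gpredXn.
  rewrite -bs_H_tconj // conjgE expg0 !mul1g expgSr invgM !mulgA mulgK.
  by [].
- exists p, q, (h^-1 ^+ (m.+1 ^ p) * x)%g.
    by rewrite gpredM // gpredXn // gpredV.
  by rewrite !mulgA -bs_H_mul_tX ?gpredV.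
Qed.

(** The power h0^j translates the rationals by j, so only j = 0 gives finite order. *)
Lemma bs_H_torsionfree x k : x \in H -> (0 < k)%N -> (x ^+ k = 1)%g -> x = 1%g.
Proof.
move=> xH k0 xk.
have: bs_act (x ^+ k)%g 0 = 0 by rewrite xk bs_act1.
case/asboolP: xH => j [|] ->;
  rewrite ?expVgn -expgnA ?bs_act_hX ?bs_act_hXV ?add0r => /eqP;
  rewrite ?oppr_eq0 pnatr_eq0 muln_eq0 orbC eqn0Ngt k0 /= => /eqP->;
  by rewrite expg0 ?invg1.
Qed.

End BaumslagSolitar.

(** * B is Hopfian when m > 0 *)

Section BaumslagSolitarGt1.
Variable m : nat.
Hypothesis m_gt0 : (0 < m)%N.
Local Notation h := (bs_h0 m).
Local Notation t := (bs_t m).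
Local Notation H := (bs_H m).

Lemma bs_slope_t_neq1 : bs_slope t != 1.
Proof. by rewrite bs_slope_t invr_eq1 pnatr_eq1 eqSS -lt0n. Qed.

(** The slope is n^(q - p), and n > 1. *)
Lemma bs_slope_normal_form p q x : x \in H ->
  bs_slope (t ^+ p * x * t ^- q)%g = 1 -> p = q.
Proof.
move=> xH; rewrite !bs_slopeM bs_slopeV !bs_slopeX (bs_slope_H xH) mulr1.
move/divr1_eq; apply: ieexprIn; [exact: bs_slope_gt0 | exact: bs_slope_t_neq1].
Qed.

Lemma bs_slope1P b : bs_slope b = 1 ->
  exists p, exists2 x, x \in H & b = (x ^ (t ^- p))%g.
Proof.
move=> b1; have [p [q [x xH bE]]] := bs_normal_form b.
have pq : p = q by apply: (bs_slope_normal_form xH); rewrite -bE.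
by exists p, x; rewrite // bE pq conjgE invgK mulgA.
Qed.

(** This conjugate sends 0 to 1/n, whereas elements of H translate by integers. *)
Lemma bs_h0_conj_notin_H : (h ^ t^-1)%g \notin H.
Proof.
apply/negP=> hH.
have: (m.+1%:R : rat)^-1 = bs_act (h ^ t^-1)%g 0.
  rewrite conjgE invgK !bs_actM bs_act_t bs_act_h bs_act_tV.
  by rewrite mul0r add0r mul1r.
move=> /(congr1 ( *%R m.+1%:R)); rewrite divff ?pnatr_eq0 //.
have n1 k : m.+1%:R * k%:R != 1 :> rat.
  by rewrite -natrM pnatr_eq1 muln_eq1 eqSS -[m == 0]negbK -lt0n m_gt0.
case/asboolP: hH => k [|] ->; rewrite ?bs_act_hX ?bs_act_hXV add0r => /esym/eqP.
  by apply/negP.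
rewrite mulrN -natrM => /eqP E; have := ler0n rat (m.+1 * k).
by rewrite -oppr_le0 E ler10.
Qed.

(** Since h0 t = t h0^n, commutation would give h0^m = 1, but h0^m moves 0 to m. *)
Lemma bs_not_commute : ~ commute h t.
Proof.
rewrite /commute bs_H_mul_t ?cyclic_id // => /mulgI.
rewrite expgS -[RHS]mulg1 => /mulgI /(congr1 (fun b => bs_act b 0)).
rewrite bs_act_hX bs_act1 add0r => /eqP.
by rewrite pnatr_eq0 eqn0Ngt m_gt0.
Qed.

Lemma bs_hopfian : hopfian (bs m).
Proof.
apply/hopfianP=> f f_surj.
(* The relation gives s = s^n for the slope s > 0 of [f h], so s^m = 1 and s = 1. *)
have fh_slope : bs_slope (f h) = 1.
  have := congr1 (fun b => bs_slope (f b)) (bs_relation m).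
  rewrite !gmulfM gmulfV gmulfXn !bs_slopeM bs_slopeV bs_slopeX.
  rewrite mulrC mulrA divff ?bs_slope_neq0 // mul1r exprS.
  rewrite -{1}[bs_slope (f h)]mulr1 => /(mulfI (bs_slope_neq0 _)) /esym/eqP.
  by rewrite pexpr_eq1 ?ltW ?bs_slope_gt0 // => /eqP.
have fH_slope x : x \in H -> bs_slope (f x) = 1.
  by case/asboolP=> k [|] ->;
    rewrite ?gmulfV gmulfXn ?bs_slopeV bs_slopeX fh_slope expr1n ?invr1.
have f_slope p q x : x \in H ->
    bs_slope (f (t ^+ p * x * t ^- q)%g) =
      bs_slope (f t) ^+ p / bs_slope (f t) ^+ q.
  move=> xH; rewrite !gmulfM gmulfV !gmulfXn !bs_slopeM bs_slopeV !bs_slopeX.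
  by rewrite (fH_slope x) // mulr1.
(* Otherwise [f] would only take values of slope 1, contradicting surjectivity at t. *)
have ft_slope : bs_slope (f t) != 1.
  have [b fb] := f_surj t; have [p [q [x xH bE]]] := bs_normal_form b.
  apply: contraNneq bs_slope_t_neq1 => ft1.
  by rewrite -fb bE f_slope // ft1 !expr1n divr1.
have [p [y yH fhE]] := bs_slope1P fh_slope.
(* If [f h] were 1, the powers of [f t] would exhaust the image, making B commutative. *)
have y1 : y <> 1%g.
  move=> y1; apply: bs_not_commute.
  have fh1 : f h = 1%g by rewrite fhE y1 conj1g.
  have im b : exists i j, f b = (f t ^+ i * f t ^- j)%g.
    have [i [j [x xH ->]]] := bs_normal_form b; exists i, j.
    rewrite !gmulfM gmulfV !gmulfXn.
    suff -> : f x = 1%g by rewrite mulg1.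
    by case/asboolP: xH => k [|] ->; rewrite ?gmulfV gmulfXn fh1 expg1n ?invg1.
  have [b <-] := f_surj h; have [c <-] := f_surj t.
  have [i [j ->]] := im b; have [k [l ->]] := im c.
  have cX u v : commute (f t ^+ u)%g (f t ^+ v)%g.
    by apply: commuteX2; exact: commute_refl.
  have cD u : commute (f t ^+ u)%g (f t ^+ k * f t ^- l)%g.
    by apply: commuteM; [exact: cX | exact/commuteV/cX].
  by apply/commute_sym/commuteM; [|apply: commuteV]; exact/commute_sym.
move=> b fb1; have [i [j [x xH bE]]] := bs_normal_form b.
have ij : i = j.
  apply: (ieexprIn (bs_slope_gt0 (f t)) ft_slope); apply/divr1_eq.
  by rewrite -(f_slope _ _ x) // -bE fb1 bs_slope1.
suff -> : b = 1%g by [].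
have fx1 : f x = 1%g.
  move/eqP: fb1; rewrite bE ij !gmulfM gmulfV.
  have -> : (f (t ^+ j) * f x * (f (t ^+ j))^-1 = f x ^ (f (t ^+ j))^-1)%g.
    by rewrite conjgE invgK mulgA.
  by rewrite conjg_eq1 => /eqP.
(* [f h] is conjugate to [y], a nontrivial element of the torsion-free group H. *)
have yX k : (f (h ^+ k) = 1 -> k = 0)%g.
  rewrite gmulfXn fhE -conjXg => /eqP; rewrite conjg_eq1 => /eqP yk.
  by case: k yk => // k /(bs_H_torsionfree yH (ltn0Sn k)).
rewrite bE ij; suff -> : x = 1%g by rewrite mulg1 mulgV.
case/asboolP: xH fx1 => k [|] -> => [/yX-> //|/eqP].
by rewrite gmulfV invg_eq1 => /eqP/yX->; rewrite invg1.
Qed.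

End BaumslagSolitarGt1.

(** * The coset map b H |-> b t H *)

Section CosetShift.
Variables (B : groupType) (H : groupClosed B) (t : B).
Hypothesis tH : forall x, x \in H -> (x ^ t)%g \in H.

(* Well defined because H t is contained in t H. *)
Definition lcos_shift (C : lcosets H) : lcosets H := lcos H (repr C * t)%g.

Lemma lcos_shiftE b : lcos_shift (lcos H b) = lcos H (b * t)%g.
Proof.
apply/lcosP; rewrite invgM -mulgA [X in (_ * X)%g]mulgA -conjgE; apply: tH.
by apply/lcosP; rewrite lcosK.
Qed.

Lemma lcos_shift_equiv b C :
  lcos_shift (lcos_mul b C) = lcos_mul b (lcos_shift C).
Proof. by rewrite -[C]lcosK lcos_mulE !lcos_shiftE lcos_mulE mulgA. Qed.

Lemma lcos_shift_surj C : exists D, lcos_shift D = C.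
Proof. by exists (lcos H (repr C / t)%g); rewrite lcos_shiftE mulgVK lcosK. Qed.

End CosetShift.

(** * Endomorphisms of a wreath product from equivariant maps *)

Section WreathMap.
Variables (A : zmodType) (B : groupType) (X : choiceType).
Variable to : left_action B X.
Variable s : X -> X.
Hypothesis s_equiv : forall b x, s (to b x) = to b (s x).

Definition wreath_map (p : wreath A to) : wreath A to := (mpush s p.1, p.2).

Lemma wreath_mapM : {morph wreath_map : p q / (p * q)%g}.
Proof.
move=> [u b] [v c].
have E : mpush s (mpush (to b) v) = mpush (to b) (mpush s v).
  by rewrite !(@mpush_comp _ _ _ _ _ _ (s \o to b)) // => x /=; rewrite s_equiv.
by rewrite /wreath_map /= raddfD /= E.
Qed.

HB.instance Definition _ :=
  monoid.isMultiplicative.Build (wreath A to) (wreath A to)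
    wreath_map wreath_mapM.

Lemma wreath_map_surj :
  (forall x, exists y, s y = x) -> forall q, exists p, wreath_map p = q.
Proof.
move=> /choice[r rK] [u b]; exists (mpush r u, b).
by rewrite /wreath_map /= (@mpush_comp _ _ _ _ _ _ id) ?mpush_id.
Qed.

(** The surjective endomorphism induced by [s] identifies the distinct elements a x and a y of the
    base group. *)
Lemma wreath_not_hopfian (a : A) (x y : X) :
  a != 0 -> x != y -> s x = s y -> (forall x, exists y, s y = x) ->
  ~ hopfian (wreath A to).
Proof.
move=> a0 xy sxy /wreath_map_surj s_surj /(_ wreath_map s_surj)/bij_inj inj.
have /inj /(congr1 (fun p : wreath A to => p.1@_x)) /= :
    wreath_map (<< a *g x >>, 1%g) = wreath_map (<< a *g y >>, 1%g).
  by rewrite /wreath_map /= !mpushU sxy.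
by rewrite !mcoeffU eqxx [y == x]eq_sym (negPf xy) => /eqP; apply/negP.
Qed.

End WreathMap.

(** * The universal property of extension of scalars *)

Section TensorLift.
Variables (R S : nzRingType) (phi : {rmorphism R -> S}) (N : lmodType R).
Variables (V : zmodType) (F : S -> N -> V).
Hypothesis FDl : forall s s' n, F (s + s') n = F s n + F s' n.
Hypothesis FDr : forall s n n', F s (n + n') = F s n + F s n'.
Hypothesis FZ : forall s r n, F (s * phi r) n = F s (r *: n).

(** The additive extension of [F] to the free abelian group on pairs; since [F] is balanced, it
    descends to the tensor product. *)
Definition tens_free_lift (u : tens_free S N) : V :=
  \sum_(p <- msupp u) F p.1 p.2 *~ u@_p.

Lemma tens_free_liftEw (d : {fset (S * N)%type}) (u : tens_free S N) :
  (msupp u `<=` d)%fset -> tens_free_lift u = \sum_(p <- d) F p.1 p.2 *~ u@_p.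
Proof.
move=> le_d; rewrite /tens_free_lift (big_fset_incl _ le_d) //= => p _.
by move=> /mcoeff_outdom ->; rewrite mulr0z.
Qed.

Lemma tens_free_lift_is_zmod_morphism : zmod_morphism tens_free_lift.
Proof.
move=> u v; rewrite (tens_free_liftEw (msuppB_le u v)).
rewrite (tens_free_liftEw (fsubsetUl (msupp u) (msupp v))).
rewrite (tens_free_liftEw (fsubsetUr (msupp u) (msupp v))).
by rewrite -sumrB; apply: eq_bigr => p _; rewrite mcoeffB mulrzBr.
Qed.

HB.instance Definition _ := GRing.isZmodMorphism.Build (tens_free S N) V
  tens_free_lift tens_free_lift_is_zmod_morphism.

Lemma tens_free_liftU s n : tens_free_lift << (s, n) >> = F s n.
Proof. by rewrite (tens_free_liftEw msuppU_le) big_seq_fset1 mcoeffUU. Qed.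

Lemma tens_free_lift_rel u : tens_rel phi u -> tens_free_lift u = 0.
Proof.
elim=> [|v w _ v0 _ w0|s s' n|s n n'|s r n].
- by rewrite raddf0.
- by rewrite raddfB /= v0 w0 subrr.
- by rewrite !raddfB /= !tens_free_liftU FDl addrAC addrK subrr.
- by rewrite !raddfB /= !tens_free_liftU FDr addrAC addrK subrr.
- by rewrite raddfB /= !tens_free_liftU FZ subrr.
Qed.

Definition tens_lift (x : ext_scalars phi N) : V := tens_free_lift (repr x).

Lemma tens_lift_class u : tens_lift (tens_class phi u) = tens_free_lift u.
Proof.
apply/eqP; rewrite -subr_eq0 -raddfB; apply/eqP/tens_free_lift_rel.
by apply/tens_classP; rewrite tens_classK.
Qed.

Lemma tens_liftE s n : tens_lift (tens phi s n) = F s n.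
Proof. by rewrite tens_lift_class tens_free_liftU. Qed.

Lemma tens_lift_is_zmod_morphism : zmod_morphism tens_lift.
Proof.
move=> x y; rewrite -[x]tens_classK -[y]tens_classK -raddfB !tens_lift_class.
by rewrite raddfB.
Qed.

End TensorLift.

Lemma ext_scalarsZ (R S : nzRingType) (phi : {rmorphism R -> S})
    (N : lmodType R) a s (n : N) :
  a *: tens phi s n = tens phi (a * s) n.
Proof. exact: tens_scaleE. Qed.

Lemma tens_lift_linear (R S : nzRingType) (phi : {rmorphism R -> S})
    (N : lmodType R) (V : lmodType S) (F : S -> N -> V) :
    (forall s s' n, F (s + s') n = F s n + F s' n) ->
    (forall s n n', F s (n + n') = F s n + F s n') ->
    (forall s r n, F (s * phi r) n = F s (r *: n)) ->
    (forall a s n, F (a * s) n = a *: F s n) ->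
  exists f : {linear ext_scalars phi N -> V},
    forall s n, f (tens phi s n) = F s n.
Proof.
move=> FDl FDr FZ FS.
pose fM := GRing.isZmodMorphism.Build _ _ (tens_lift F)
  (tens_lift_is_zmod_morphism FDl FDr FZ).
pose f : {additive ext_scalars phi N -> V} := HB.pack (tens_lift F) fM.
have fE s n : f (tens phi s n) = F s n by exact: tens_liftE.
have f_lin : scalable f.
  move=> a x; elim/tens_ind: x => [s n|x y IHx IHy].
    by rewrite ext_scalarsZ !fE FS.
  by rewrite scalerBr !raddfB IHx IHy.
pose fL := GRing.isScalable.Build _ _ _ _ (f : _ -> _) f_lin.
pose g : {linear ext_scalars phi N -> V} := HB.pack (f : _ -> _) fM fL.
by exists g.
Qed.

(** * Endomorphisms of the induced module and H-fixed vectors *)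

Section InducedEnd.
Variables (K : comUnitRingType) (B : groupType) (H : groupClosed B).
Local Notation KB := (group_ring K B).
Local Notation Ind := (induced K H).
Local Notation gr a b := (<< (a : K) *g (b : B) >> : KB).
Local Notation tn s x :=
  (tens (@gr_incl K B H) s (x : trivial_module K (subgrp H))).

Lemma group_ring_mulUU a a' b b' : gr a b * gr a' b' = gr (a * a') (b * b')%g.
Proof. exact: gr_mulUU. Qed.

Lemma gr_inclU a (b : subgrp H) :
  gr_incl (<< a *g b >> : group_ring K (subgrp H)) = gr a (val b).
Proof. exact: mpushU. Qed.

(** In K[B/H] this vector is the coset H. *)
Definition ind_unit : Ind := tn 1 1.

Lemma gr_center a (u : KB) : u * gr a 1%g = gr a 1%g * u.
Proof.
rewrite [u]monalgE mulr_suml mulr_sumr; apply: eq_bigr => b _.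
by rewrite !group_ring_mulUU mulg1 mul1g mulrC.
Qed.

(** Each element of H acts as the identity on [v], so only the sum of the coefficients of [r]
    matters. *)
Lemma gr_aug_incl_fixed (v : Ind) :
    (forall b, b \in H -> gr 1 b *: v = v) ->
  forall r : group_ring K (subgrp H), gr_incl r *: v = gr (gr_aug r) 1%g *: v.
Proof.
move=> vH r.
have grU (x : K) b : gr x b = gr x 1%g * gr 1 b.
  by rewrite group_ring_mulUU mulr1 mul1g.
rewrite [in LHS](monalgE r) raddf_sum /= /gr_aug.
rewrite (raddf_sum (mkmalgU (1%g : B))) !scaler_suml.
apply: eq_bigr => b _; rewrite gr_inclU grU -scalerA vH //.
exact: valP.
Qed.

(** The vector 1 (x) 1 generates the module, because s (x) x = (s x) (1 (x) 1). *)
Lemma ind_unit_ext (f g : endring Ind) :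
  endfun f ind_unit = endfun g ind_unit -> f = g.
Proof.
move=> fg; apply: endringP; elim/tens_ind => [s x|x y fgx fgy]; last first.
  by rewrite !raddfB /= fgx fgy.
suff -> : tn s x = (s * gr x 1%g) *: ind_unit by rewrite !linearZ /= fg.
rewrite /ind_unit ext_scalarsZ mulr1.
have -> : gr x 1%g = gr_incl (<< x *g 1%g >> : group_ring K (subgrp H)).
  by rewrite gr_inclU.
by rewrite tensZ /GRing.scale /= /triv_scale gr_augU mulr1.
Qed.

(* Frobenius reciprocity. *)
Lemma ind_end_exists (v : Ind) :
    (forall b, b \in H -> gr 1 b *: v = v) ->
  exists f : endring Ind, endfun f ind_unit = v.
Proof.
move=> vH.
pose F (s : KB) (x : trivial_module K (subgrp H)) : Ind := (s * gr x 1%g) *: v.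
have FDl s s' x : F (s + s') x = F s x + F s' x by rewrite /F mulrDl scalerDl.
have FDr s x x' : F s (x + x') = F s x + F s x'.
  by rewrite /F -scalerDl -mulrDr -monalgUD.
have FZ s r x : F (s * gr_incl r) x = F s (r *: x).
  have rx : r *: x = gr_aug r * (x : K) :> K by [].
  have sx : s * gr_incl r * gr x 1%g = s * gr x 1%g * gr_incl r.
    by rewrite -!mulrA gr_center.
  rewrite /F sx -scalerA (gr_aug_incl_fixed vH) scalerA -mulrA group_ring_mulUU.
  by rewrite mulg1 rx [(x : K) * _]mulrC.
have FS a s x : F (a * s) x = a *: F s x by rewrite /F scalerA mulrA.
have [f fE] := tens_lift_linear FDl FDr FZ FS.
exists (end_of f); rewrite end_ofE fE /F mul1r; exact: scale1r.
Qed.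

(** Under Ind = K[B/H], the coefficient of s (1 (x) 1) at the coset c H. *)
Definition ind_coef (c : B) (s : KB) : K := (mpush (lcos H) s)@_(lcos H c).

Lemma ind_coefU c a b : ind_coef c (gr a b) = a *+ (lcos H b == lcos H c).
Proof. by rewrite /ind_coef mpushU mcoeffU. Qed.

Lemma ind_coef_is_zmod_morphism c : zmod_morphism (ind_coef c).
Proof. by move=> s s'; rewrite /ind_coef !raddfB. Qed.

HB.instance Definition _ c :=
  GRing.isZmodMorphism.Build KB K (ind_coef c) (ind_coef_is_zmod_morphism c).

(** Right multiplication by an element of H preserves left cosets. This makes [ind_coef c] balanced
    over KH. *)
Lemma ind_coef_incl c s (r : group_ring K (subgrp H)) :
  ind_coef c (s * gr_incl r) = ind_coef c s * gr_aug r.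
Proof.
rewrite [r]monalgE (raddf_sum (@gr_incl K B H)).
rewrite (raddf_sum (@gr_aug K (subgrp H))).
rewrite !mulr_sumr raddf_sum; apply: eq_bigr => d _.
rewrite [s]monalgE mulr_suml !raddf_sum mulr_suml; apply: eq_bigr => b _.
rewrite /= gr_inclU group_ring_mulUU gr_augU /= !ind_coefU mulrnAl.
congr (_ *+ (_ == _)).
by apply/esym/lcosP; rewrite mulKg; exact: valP.
Qed.

(** The coefficient at c H defines a functional on the tensor product; its value is 1 at c (1 (x)
    1), but 0 at 1 (x) 1 unless c H = H. *)
Lemma ind_unit_eq c : gr 1 c *: ind_unit = ind_unit -> c \in H.
Proof.
pose F (s : KB) (x : trivial_module K (subgrp H)) : K := ind_coef c s * (x : K).
have FDl s s' x : F (s + s') x = F s x + F s' x by rewrite /F raddfD mulrDl.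
have FDr s x x' : F s (x + x') = F s x + F s x' by exact: mulrDr.
have FZ s r x : F (s * gr_incl r) x = F s (r *: x).
  by rewrite /F ind_coef_incl -mulrA.
have liftE s x : tens_lift F (tn s x) = F s x by exact: tens_liftE.
have coef1 : ind_coef c 1 = 1 *+ (lcos H 1%g == lcos H c).
  exact: (ind_coefU c 1 1%g).
rewrite /ind_unit ext_scalarsZ mulr1 => cE.
have F_eq : F (gr 1 c) 1 = F 1 1 by rewrite -!liftE cE.
have : ind_coef c (gr 1 c) = ind_coef c 1 by rewrite -[LHS]mulr1 -[RHS]mulr1.
rewrite ind_coefU coef1 eqxx mulr1n.
case: (lcos H 1%g =P lcos H c) => [/lcosP|_ /eqP]; first by rewrite invg1 mul1g.
by rewrite mulr0n oner_eq0.
Qed.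

Lemma ind_unit_fixed b : b \in H -> gr 1 b *: ind_unit = ind_unit.
Proof.
move=> bH; rewrite /ind_unit ext_scalarsZ mulr1.
have -> : gr 1 b = 1 *
    gr_incl (<< 1 *g (Sub b bH : subgrp H) >> : group_ring K (subgrp H)).
  by rewrite mul1r gr_inclU.
rewrite tensZ; congr (tens _ _ _).
by rewrite /GRing.scale /= /triv_scale gr_augU mulr1.
Qed.

End InducedEnd.

(** * Fixed vectors of cyclic subgroups and the transfer over B *)

Section FixedCyclic.
Variables (K : comUnitRingType) (B : groupType) (M : lmodType (group_ring K B)).

Lemma gr_scaleM (a a' : K) (b b' : B) (v : M) :
  (<< a *g b >> : group_ring K B) *: ((<< a' *g b' >> : group_ring K B) *: v) =
  (<< a * a' *g (b * b')%g >> : group_ring K B) *: v.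
Proof. by rewrite scalerA group_ring_mulUU. Qed.

Lemma gr_scaleM1 (b b' : B) (v : M) :
  (<< 1 *g b >> : group_ring K B) *: ((<< 1 *g b' >> : group_ring K B) *: v) =
  (<< 1 *g (b * b')%g >> : group_ring K B) *: v.
Proof. by rewrite gr_scaleM mulr1. Qed.

Lemma fixed_cyclic (x : B) (v : M) :
    (<< 1 *g x >> : group_ring K B) *: v = v ->
  forall y, y \in cyclic x -> (<< 1 *g y >> : group_ring K B) *: v = v.
Proof.
move=> xv.
have g1 : (<< 1 *g 1%g >> : group_ring K B) *: v = v by exact: scale1r.
have xXv k : (<< 1 *g (x ^+ k)%g >> : group_ring K B) *: v = v.
  by elim: k => [|k IHk]; rewrite ?expg0 // expgS -gr_scaleM1 IHk.
by move=> _ /asboolP[k [|] ->] //; rewrite -[in LHS](xXv k) gr_scaleM1 mulVg.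
Qed.

End FixedCyclic.

Section BaumslagSolitarModule.
Variables (m : nat) (K : comUnitRingType).
Local Notation h := (bs_h0 m).
Local Notation t := (bs_t m).
Local Notation H := (bs_H m).
Local Notation KB := (group_ring K (bs m)).
Local Notation gr a b := (<< (a : K) *g b >> : KB).
Local Notation ninv := ((m.+1%:R : K)^-1).
Variables (M : lmodType KB) (u : M).
Hypothesis hu : gr 1 h *: u = u.

Let Hu b : b \in H -> gr 1 b *: u = u.
Proof. exact: fixed_cyclic. Qed.

(* The average of the n = m + 1 preimages of the coset H under b H |-> b t H,
   namely the cosets h0^i t^-1 H for i < n. *)
Definition bs_transfer : M := \sum_(i < m.+1) gr ninv (h ^+ i * t^-1)%g *: u.

(** From b t = t b^n. For u = 1 (x) 1 this shows that b H |-> b t H induces an endomorphism. *)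
Lemma bs_shift_fixed b : b \in H -> gr 1 b *: (gr 1 t *: u) = gr 1 t *: u.
Proof.
move=> bH; rewrite gr_scaleM1 (bs_H_mul_t bH) -gr_scaleM1.
by rewrite (Hu (gpredXn m.+1 bH)).
Qed.

(** Multiplication by h0 shifts the index, and the last term wraps around to the first by h0^n t^-1
    = t^-1 h0. *)
Lemma bs_transfer_fixed b : b \in H -> gr 1 b *: bs_transfer = bs_transfer.
Proof.
apply: fixed_cyclic b; rewrite /bs_transfer scaler_sumr.
rewrite big_ord_recr [RHS]big_ord_recl /= addrC; congr (_ + _).
  rewrite gr_scaleM mul1r mulgA -expgS mul1g.
  have -> : (h ^+ m.+1 * t^-1 = t^-1 * h)%g.
    by rewrite -bs_relation -mulgA mulgV mulg1.
  by rewrite -[ninv in LHS]mulr1 -gr_scaleM hu.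
by apply: eq_bigr => i _; rewrite gr_scaleM mul1r mulgA -expgS.
Qed.

(** Each of the n summands equals u / n, because t^-1 t cancels and h0^i fixes u. *)
Lemma bs_transfer_shift : m.+1%:R \is a @GRing.unit K ->
  \sum_(i < m.+1) gr ninv (h ^+ i * t^-1)%g *: (gr 1 t *: u) = u.
Proof.
move=> n_unit; rewrite (eq_bigr (fun=> gr ninv 1%g *: u)) => [|i _]; last first.
  rewrite gr_scaleM mulgVK -[in LHS](mul1g (h ^+ i)%g).
  by rewrite -gr_scaleM (Hu (cyclicX h i)).
have ninvMn : ninv *+ m.+1 = 1 by rewrite -(mulr_natl ninv) divrr.
rewrite -scaler_suml sumr_const card_ord -monalgUMn ninvMn.
exact: scale1r.
Qed.

(** From (t h0 t^-1) t = t h0. This is where injectivity of the shift fails. *)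
Lemma bs_conj_shift : gr 1 (h ^ t^-1)%g *: (gr 1 t *: u) = gr 1 t *: u.
Proof.
rewrite gr_scaleM1 conjgE invgK -!mulgA mulVg mulg1.
by rewrite -gr_scaleM1 hu.
Qed.

End BaumslagSolitarModule.

(** * Failure of direct finiteness and of the Hopf property *)

Lemma bs_ind_end_not_directly_finite (m : nat) (K : comUnitRingType) :
  (0 < m)%N -> (m.+1%:R : K) \is a GRing.unit ->
  ~ directly_finite (endring (induced K (bs_H m))).
Proof.
move=> m_gt0 n_unit fin.
have hu : (<< 1 *g bs_h0 m >> : group_ring K (bs m)) *: ind_unit K (bs_H m) =
    ind_unit K (bs_H m) by apply/ind_unit_fixed/cyclic_id.
(* [f] is induced by b H |-> b t H, and [g] averages over preimages. *)
have [f fu] := ind_end_exists (bs_shift_fixed hu).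
have [g gu] := ind_end_exists (bs_transfer_fixed hu).
have fZ a x : endfun f (a *: x) = a *: endfun f x by exact: linearZ.
have fg : f * g = 1.
  apply: ind_unit_ext.
  transitivity (endfun f (endfun g (ind_unit K (bs_H m)))) => //.
  rewrite gu /bs_transfer raddf_sum -[RHS](bs_transfer_shift hu n_unit).
  by apply: eq_bigr => i _; rewrite -fu; exact: fZ.
have gfE x : endfun g (endfun f x) = x.
  by rewrite -[RHS]/(endfun 1 x) -(fin f g fg).
(* For c = t h0 t^-1, [f] identifies c (1 (x) 1) with 1 (x) 1; as g f = 1, these would be equal and
   c would lie in H. *)
have := bs_h0_conj_notin_H m_gt0; apply/negP/negPn/(@ind_unit_eq K).
rewrite -[LHS]gfE -[RHS]gfE; congr (endfun g _).
by rewrite fZ fu; exact: bs_conj_shift.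
Qed.

Theorem propositionA (m : nat) (hm : (2 <= m)%N) :
  (forall K : comUnitRingType, (m.+1%:R : K) \is a GRing.unit ->
     ~ directly_finite (endring (induced K (bs_H m))))
  /\ (hopfian (bs m) /\ ~ hopfian (wreath 'Z_m (lcos_action (bs_H m)))).
Proof.
have m_gt0 : (0 < m)%N by exact: ltnW.
split; first by move=> K; exact: bs_ind_end_not_directly_finite.
split; first exact: bs_hopfian.
have tH x : x \in bs_H m -> (x ^ bs_t m)%g \in bs_H m.
  by move=> xH; rewrite bs_H_tconj // gpredXn.
(* The shift sends both cosets t h0 t^-1 H and H to t H. *)
apply: (@wreath_not_hopfian _ _ _ _ (lcos_shift (bs_t m)) _ 1
  (lcos _ (bs_h0 m ^ (bs_t m)^-1)%g) (lcos _ 1%g)).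
- exact: lcos_shift_equiv.
- exact: oner_neq0.
- apply: contra (bs_h0_conj_notin_H m_gt0) => /eqP/esym/lcosP.
  by rewrite invg1 mul1g.
- rewrite !lcos_shiftE // mul1g conjgE invgK -!mulgA mulVg mulg1.
  apply/esym/lcosP; rewrite mulKg; exact: cyclic_id.
- exact: lcos_shift_surj.
Qed.
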